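(* Suppose (A1) $\lim_{x\to\infty}f(x)=+\infty$; (A2) $\nabla f(x)\neq 0$ in the feasible set $\Omega$; (A3) $\nabla g(x)\neq 0$ in $\Omega$; (A4) $f$ and $g$ are twice continuously differentiable. Let $x_\zeta^\sharp$ be the first point where the trajectory $x(t;\zeta,x_0)$ reaches the boundary of the feasible set. Then $$x_\zeta^\sharp\in\{x: g(x)=0,\ \cos\theta\le-\zeta\}.$$ This is to say that the point $x_\zeta^\sharp$ belongs to the closure of the $\zeta$-neighborhood $\Theta_\zeta$ of the central path. Especially, the limit of $x_\zeta^\sharp$ as $\zeta\to1^-$ is at the intersection of the central path and the boundary of the feasible set.
   Context: Let $f,g:\mathbb{R}^n\to\mathbb{R}$ and let $\Omega=\{x\in\mathbb{R}^n: g(x)\le 0\}$ be the feasible set. $|\cdot|$ is the Euclidean norm. $\theta=\theta(x)$ is the angle between $\nabla f(x)$ and $\nabla g(x)$. The central path is the set of points of $\Omega$ with $\frac{\nabla f}{|\nabla f|}+\frac{\nabla g}{|\nabla g|}=0$, i.e. with $\cos\theta=-1$. For $\mu\in[0,1]$ the $\mu$-neighborhood of the central path is $\Theta_\mu=\{x: g(x)\le0,\ \cos\theta<-\mu\}$. For $\zeta\in[0,1)$ let $\mathbf{s}_\zeta=-\frac{\nabla f}{|\nabla f|}-\zeta\frac{\nabla g}{|\nabla g|}$, and let $x(t;\zeta,x_0)$ be the solution of $\frac{dx}{dt}=\mathbf{s}_\zeta(x)$, $x|_{t=0}=x_0$, with initial design $x_0$ in the feasible set $\Omega$.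
   Formalization: Reaching the boundary means at a time T>0, from the interior on (0,T). The limit as ζ→1⁻ need not exist: shown instead is that if it exists it lies in the intersection, and that cluster points exist and all lie there. *)

(* Defs.v *)
(* MathComp-Analysis *)
From HB Require Import structures.
From mathcomp Require Import all_boot all_order all_algebra.
From mathcomp Require Import all_classical all_reals all_analysis.

Set Implicit Arguments.
Unset Strict Implicit.
Unset Printing Implicit Defensive.

Import Order.TTheory GRing.Theory Num.Theory.
Import numFieldNormedType.Exports.

Local Open Scope classical_set_scope.
Local Open Scope ring_scope.

Section Euclidean.
Context {R : realType} {n : nat}.
Implicit Types u v : 'rV[R]_n.

Definition dot u v : R := \sum_(i < n) u 0 i * v 0 i.

(* The library norm on 'rV[R]_n is the sup norm (with the same topology), hence
   a separate Euclidean norm. *)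
Definition enorm u : R := Num.sqrt (dot u u).

Definition normalize u : 'rV[R]_n := (enorm u)^-1 *: u.

(* Junk value pi / 2 when u or v is zero. *)
Definition angle u v : R := acos (dot u v / (enorm u * enorm v)).

End Euclidean.

Section Optimization.
Context {R : realType} {n : nat}.
Implicit Types (f g : 'rV[R]_n -> R) (x : R -> 'rV[R]_n) (p : 'rV[R]_n).

Definition grad f p : 'rV[R]_n := \row_(i < n) 'D_(delta_mx 0 i) f p.

Definition C2 f : Prop :=
  [/\ forall p, differentiable f p,
      forall p, differentiable (grad f) p &
      continuous (jacobian (grad f))].

Definition coercive f : Prop :=
  forall A : R, exists r : R, forall p, r < enorm p -> A < f p.

Definition feasible g : set 'rV[R]_n := [set p | g p <= 0].

Definition boundary (A : set 'rV[R]_n) : set 'rV[R]_n := closure A `\` A°.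

Definition theta f g p : R := angle (grad f p) (grad g p).

Definition central_path f g : set 'rV[R]_n :=
  [set p | feasible g p /\ normalize (grad f p) + normalize (grad g p) = 0].

Definition Theta f g (mu : R) : set 'rV[R]_n :=
  [set p | feasible g p /\ cos (theta f g p) < - mu].

Definition sfield f g (zeta : R) p : 'rV[R]_n :=
  - normalize (grad f p) - zeta *: normalize (grad g p).

(* The curve solves the differential equation for as long as it has not left
   the feasible set; outside of it the gradients may vanish, so the field need
   not be defined there, and the values of x after leaving the feasible set
   are irrelevant.  At time 0 the equation holds for the right derivative, by
   continuity of x at 0 and of the field at x0. *)
Definition trajectory f g (zeta : R) (x0 : 'rV[R]_n) x : Prop :=
  [/\ x 0 = x0,
      {within `[0, +oo[, continuous x} &
      forall t : R, 0 < t -> (forall s, 0 <= s <= t -> feasible g (x s)) ->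
        is_derive t 1 x (sfield f g zeta (x t))].

(* Automatic when x 0 is an interior point; it fails for a starting point on
   the boundary from which the curve leaves the feasible set at once. *)
Definition enters_interior g x : Prop :=
  \forall t \near (0 : R)^'+, (feasible g)° (x t).

(* T > 0: a curve starting on the boundary is not regarded as having reached
   it at time 0, it reaches the boundary when it comes to it from the
   interior. *)
Definition first_reaches_boundary g x (T : R) : Prop :=
  [/\ 0 < T,
      forall t, 0 < t < T -> (feasible g)° (x t) &
      boundary (feasible g) (x T)].

End Optimization.

(* Main.v *)
Require Import Defs.
From mathcomp Require Import all_boot all_order all_algebra.
From mathcomp Require Import all_classical all_reals all_analysis.
From mathcomp Require Import ring lra.

Import Order.TTheory GRing.Theory Num.Theory.
Import numFieldNormedType.Exports.

Local Open Scope classical_set_scope.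
Local Open Scope ring_scope.

(** Write [s] for the field [- grad f / |grad f| - zeta grad g / |grad g|] and
    [x] for a trajectory.

    The boundary is reached.  Along [x] the objective has rate
    [grad f . s = - |grad f| (1 + zeta cos theta) <= - (1 - zeta) |grad f|]
    ([objective_rate]).  While [x] is feasible it therefore stays in the set
    [f <= f x0, g <= 0], which is compact because [f] is coercive.  There
    [|grad f|] has a positive minimum, so [f] would decrease at least linearly
    forever, although it is bounded below: [x] has to leave the feasible set
    ([trajectory_leaves]), and the infimum of the times at which it is not in
    the interior is the time of first arrival ([first_reach_exists]).

    Where it is reached.  The rate of the constraint is
    [grad g . s = - |grad g| (cos theta + zeta)], positive exactly on
    [cos theta < - zeta] ([constraint_rate_gt0]).  Interior points of the
    feasible set satisfy [g < 0], because a zero of [g] there would be a local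
    maximum, hence critical ([interior_feasible_lt0]).  So [g] goes from a
    negative value to [0] on each interval [[a, T]] ending at the arrival time
    [T], and by the mean value theorem its rate is positive at an intermediate
    time, at which [x] belongs to [Theta f g zeta].  As [a] tends to [T], this
    gives the membership of [x T] in the closure of [Theta f g zeta]
    ([first_reach_closure]).  It is stronger than the inequality
    [cos theta <= - zeta] at [x T], which follows since that inequality
    defines a relatively closed set ([closure_Theta]).

    The limit.  All arrival points lie in the compact set
    [f <= f x0, g <= 0], so they have a cluster point when [zeta] tends to
    [1].  Such a point satisfies [g = 0] and [cos theta <= - z] for every
    [z < 1], both being closed conditions, hence [cos theta <= -1]
    ([obtuse_limit]); then the sum of the normalized gradients, whose square
    is [2 + 2 cos theta], vanishes ([normalize_opposite]).  A limit is a
    particular cluster point. *)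

(** * Euclidean geometry and gradients of row vectors *)

Section EuclideanTheory.
Context {R : realType} {n : nat}.
Implicit Types u v w : 'rV[R]_n.

Lemma dotC u v : dot u v = dot v u.
Proof. by apply: eq_bigr => i _; rewrite mulrC. Qed.

Lemma dotDr u v w : dot u (v + w) = dot u v + dot u w.
Proof. by rewrite -big_split; apply: eq_bigr => i _; rewrite mxE mulrDr. Qed.

Lemma dotZr (a : R) u v : dot u (a *: v) = a * dot u v.
Proof. by rewrite big_distrr; apply: eq_bigr => i _; rewrite mxE mulrCA. Qed.

Lemma dotNr u v : dot u (- v) = - dot u v.
Proof. by rewrite -scaleN1r dotZr mulN1r. Qed.

Lemma dot_ge0 u : 0 <= dot u u.
Proof. by apply: sumr_ge0 => i _; rewrite -expr2 sqr_ge0. Qed.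

Lemma dot_eq0 u : (dot u u == 0) = (u == 0).
Proof.
apply/idP/eqP => [|->]; last by rewrite /dot big1 // => i _; rewrite mxE mul0r.
rewrite psumr_eq0 => [/allP u0|i _]; last by rewrite -expr2 sqr_ge0.
apply/rowP => i; have := u0 i (mem_index_enum i).
by rewrite mxE /= -expr2 sqrf_eq0 => /eqP.
Qed.

Lemma enorm_sqr u : enorm u ^+ 2 = dot u u.
Proof. by rewrite sqr_sqrtr ?dot_ge0. Qed.

Lemma enorm_gt0 u : u != 0 -> 0 < enorm u.
Proof. by move=> u0; rewrite sqrtr_gt0 lt_neqAle eq_sym dot_eq0 u0 dot_ge0. Qed.

Lemma dot_normalize u : u != 0 -> dot u (normalize u) = enorm u.
Proof.
by move=> /enorm_gt0 u0; rewrite dotZr -enorm_sqr expr2 mulKf ?gt_eqF.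
Qed.

Lemma dot_comb (a b : R) u v : dot (a *: u + b *: v) (a *: u + b *: v) =
  a ^+ 2 * enorm u ^+ 2 + 2 * (a * b * dot u v) + b ^+ 2 * enorm v ^+ 2.
Proof.
rewrite !enorm_sqr dotDr !dotZr [dot (_ + _) u]dotC [dot (_ + _) v]dotC.
by rewrite !dotDr !dotZr (dotC v u); ring.
Qed.

(** The squares of [|v| u + |u| v] and [|v| u - |u| v] are nonnegative; each is
    [2 |u| |v|] times the gap in one of the two inequalities. *)
Lemma cauchy_schwarz u v : u != 0 -> v != 0 -> `|dot u v| <= enorm u * enorm v.
Proof.
move=> /enorm_gt0 u0 /enorm_gt0 v0; have uv0 := mulr_gt0 u0 v0.
have pos := dot_ge0 (enorm v *: u + enorm u *: v).
have neg := dot_ge0 (enorm v *: u + (- enorm u) *: v).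
move: pos neg; rewrite !dot_comb ler_norml; move: (dot u v) => d pos neg.
by apply/andP; split; rewrite -subr_ge0 -(pmulr_rge0 _ uv0); nra.
Qed.

(** [acos] is inverted by [cos] only on [[-1, 1]]: Cauchy-Schwarz puts the
    quotient there. *)
Lemma cos_angle u v : u != 0 -> v != 0 ->
  cos (angle u v) = dot u v / (enorm u * enorm v).
Proof.
move=> u0 v0; have uv0 := mulr_gt0 (enorm_gt0 u u0) (enorm_gt0 v v0).
rewrite acosK // in_itv /= -ler_norml normrM normfV (gtr0_norm uv0).
by rewrite ler_pdivrMr // mul1r cauchy_schwarz.
Qed.

Lemma cos_angle_le u v (c : R) : u != 0 -> v != 0 ->
  (cos (angle u v) <= c) = (dot u v <= c * (enorm u * enorm v)).
Proof.
by move=> u0 v0; rewrite cos_angle // ler_pdivrMr // mulr_gt0 ?enorm_gt0.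
Qed.

Lemma cos_angle_lt u v (c : R) : u != 0 -> v != 0 ->
  (cos (angle u v) < c) = (dot u v < c * (enorm u * enorm v)).
Proof.
by move=> u0 v0; rewrite cos_angle // ltr_pdivrMr // mulr_gt0 ?enorm_gt0.
Qed.

(** The square of the sum of two unit vectors is [2 + 2 cos theta]. *)
Lemma normalize_opposite u v : u != 0 -> v != 0 -> cos (angle u v) <= -1 ->
  normalize u + normalize v = 0.
Proof.
move=> u0 v0; rewrite cos_angle_le // mulN1r => uv.
have [eu ev] := (enorm_gt0 u u0, enorm_gt0 v v0).
apply/eqP; rewrite -dot_eq0 eq_le dot_ge0 andbT dot_comb.
have -> : (enorm u)^-1 ^+ 2 * enorm u ^+ 2 +
    2 * ((enorm u)^-1 * (enorm v)^-1 * dot u v) +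
    (enorm v)^-1 ^+ 2 * enorm v ^+ 2
  = 2 * ((dot u v + enorm u * enorm v) / (enorm u * enorm v)).
  by field; rewrite !gt_eqF.
by rewrite pmulr_rle0 // pmulr_lle0 ?invr_gt0 ?mulr_gt0 // -lerBrDr sub0r.
Qed.

(** Coercivity is expressed with the Euclidean norm, boundedness with the sup
    norm; this comparison connects them. *)
Lemma norm_le_enorm u : `|u| <= enorm u.
Proof.
rewrite [leLHS]/Num.Def.normr/= mx_normrE; apply/bigmax_leP.
split=> [|[i j] _]; first exact: sqrtr_ge0.
rewrite -(ler_pXn2r (n := 2)) ?nnegrE ?normr_ge0 ?sqrtr_ge0 // enorm_sqr.
rewrite real_normK ?num_real // (ord1 i) /dot (bigD1 j) //= -expr2 lerDl.
by apply: sumr_ge0 => k _; rewrite -expr2 sqr_ge0.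
Qed.

Lemma dot_continuous {T : topologicalType} (F G : T -> 'rV[R]_n) :
  continuous F -> continuous G -> continuous (fun p => dot (F p) (G p)).
Proof.
move=> cF cG; rewrite /dot; apply: continuous_big; first exact: add_continuous.
move=> i _ p; apply: cvgM.
  by apply: (@continuous_comp _ _ _ F (fun u : 'rV[R]_n => u 0 i));
    [exact: cF|exact: coord_continuous].
by apply: (@continuous_comp _ _ _ G (fun u : 'rV[R]_n => u 0 i));
    [exact: cG|exact: coord_continuous].
Qed.

Lemma enorm_continuous {T : topologicalType} (F : T -> 'rV[R]_n) :
  continuous F -> continuous (fun p => enorm (F p)).
Proof.
move=> cF p; apply: (@continuous_comp _ _ _ (fun p => dot (F p) (F p)) Num.sqrt).
  exact: dot_continuous.
exact: sqrt_continuous.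
Qed.

(** A differential is linear, so it is determined by the partial derivatives. *)
Lemma diff_grad (h : 'rV[R]_n -> R) p v : differentiable h p ->
  'd h p v = dot (grad h p) v.
Proof.
move=> dh; rewrite {1}(row_sum_delta v) linear_sum; apply: eq_bigr => i _.
by rewrite linearZ /= mxE deriveE // mulrC.
Qed.

Lemma is_derive_comp_grad (h : 'rV[R]_n -> R) (x : R -> 'rV[R]_n) (t : R) v :
  differentiable h (x t) -> is_derive t 1 x v ->
  is_derive t 1 (h \o x) (dot (grad h (x t)) v).
Proof.
move=> dh [/derivable1_diffP dx xv].
have dhx : differentiable (h \o x) t by exact: differentiable_comp.
split; first exact/derivable1_diffP.
by rewrite deriveE // diff_comp //= diff_grad // -xv deriveE //;
  exact/derivable1_diffP.
Qed.
End EuclideanTheory.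

(** * The feasible set and its boundary *)

Section FeasibleSet.
Context {R : realType} {n : nat}.
Implicit Types (g h : 'rV[R]_n -> R) (p u v : 'rV[R]_n).

Lemma closed_sublevel h (a : R) : continuous h -> closed [set p | h p <= a].
Proof.
move=> /continuous_closedP ch.
by apply: (ch [set y | y <= a]); exact: closed_le.
Qed.

Lemma closed_level h (a : R) : continuous h -> closed [set p | h p = a].
Proof.
by move=> /continuous_closedP ch; apply: (ch [set a]); exact: closed_eq.
Qed.

Lemma lt0_interior_feasible g p :
  continuous g -> g p < 0 -> (feasible g)° p.
Proof. by move=> cg gp; apply: filterS (cvgr_lt _ (cg p) _ gp) => q /ltW. Qed.

(** If [g p >= 0], then [g] is positive at the points [p + h u], for
    [u = grad g p] and small [h > 0], because the slope of [g] in the direction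
    [u] is [|u|^2 > 0]; such points are infeasible and arbitrarily close to
    [p]. *)
Lemma interior_feasible_lt0 g p : differentiable g p -> grad g p != 0 ->
  (feasible g)° p -> g p < 0.
Proof.
move=> dg g0 intp; rewrite ltNge; apply/negP => gp.
pose u := grad g p.
have slope : h^-1 *: ((g \o shift p) (h *: u) - g p) @[h --> (0 : R)^']
    --> dot u u.
  by rewrite -diff_grad // -deriveE //; exact: diff_derivable.
have line : h *: u + p @[h --> (0 : R)^'+] --> p.
  apply: cvg_at_right_filter; rewrite -[X in _ --> X]add0r -(scale0r u).
  by apply: cvgD; [apply: cvgZr_tmp; exact: cvg_id|exact: cvg_cst].
have uu0 : 0 < dot u u by rewrite -enorm_sqr exprn_gt0 ?enorm_gt0.
have pos := cvgr_gt _ (cvg_dnbhs_at_right slope) _ uu0.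
have feas := line _ intp.
near (0 : R)^'+ => h.
have h0 : 0 < h by near: h; exact: nbhs_right_gt.
have : g (h *: u + p) <= 0 by near: h; exact: feas.
have : 0 < h^-1 *: ((g \o shift p) (h *: u) - g p) by near: h; exact: pos.
rewrite pmulr_rgt0 ?invr_gt0 //= subr_gt0 => gt.
by rewrite leNgt (le_lt_trans gp gt).
Unshelve. all: by end_near. Qed.

Lemma boundary_feasible g p : (forall p, differentiable g p) ->
  (feasible g p -> grad g p != 0) -> boundary (feasible g) p <-> g p = 0.
Proof.
move=> dg reg; have cg : continuous g.
  by move=> q; exact: differentiable_continuous.
split=> [[]|gp].
  rewrite -(proj1 (closure_id _) (closed_sublevel g 0 cg)) => gp nint.
  apply/eqP; rewrite eq_le gp leNgt; apply/negP => /(lt0_interior_feasible _ _ cg).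
  exact: nint.
have fp : feasible g p by rewrite /feasible /= gp.
split; first exact: subset_closure.
by move=> /(interior_feasible_lt0 _ _ (dg p) (reg fp)); rewrite gp ltxx.
Qed.

Lemma compact_sublevel (f g : 'rV[R]_n -> R) (a : R) : coercive f ->
  continuous f -> continuous g -> compact [set p | f p <= a /\ g p <= 0].
Proof.
move=> cof cf cg; apply: bounded_closed_compact.
  have [r rP] := cof a; exists r; split=> [|M rM p [fp _] /=]; first exact: num_real.
  rewrite (le_trans (norm_le_enorm p)) // (le_trans _ (ltW rM)) // leNgt.
  by apply/negP => /rP; rewrite ltNge fp.
exact: closedI (closed_sublevel _ _ cf) (closed_sublevel _ _ cg).
Qed.
End FeasibleSet.

(** * Rates of change along the search direction *)

Section Field.
Context {R : realType} {n : nat}.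

Lemma obtuse_continuous {T : topologicalType} (F G : T -> 'rV[R]_n) (z : R) :
  continuous F -> continuous G ->
  continuous (fun p => dot (F p) (G p) + z * (enorm (F p) * enorm (G p))).
Proof.
move=> cF cG p; apply: cvgD; first exact: dot_continuous.
apply: cvgM; first exact: cvg_cst.
by apply: cvgM; exact: enorm_continuous.
Qed.

Variables (f g : 'rV[R]_n -> R).
Implicit Types (p : 'rV[R]_n) (z : R).

(** The exact rate is [- |grad f| (1 + z cos theta)], and [cos theta >= -1]. *)
Lemma objective_rate z p : 0 <= z -> grad f p != 0 -> grad g p != 0 ->
  dot (grad f p) (sfield f g z p) <= - ((1 - z) * enorm (grad f p)).
Proof.
move=> z0 f0 g0; have e0 := enorm_gt0 _ g0.
rewrite dotDr !dotNr dot_normalize // !dotZr.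
have : - enorm (grad f p) <= (enorm (grad g p))^-1 * dot (grad f p) (grad g p).
  rewrite mulrC ler_pdivlMr // mulNr.
  by have := cauchy_schwarz _ _ f0 g0; rewrite ler_norml => /andP[].
by move/(ler_wpM2l z0); lra.
Qed.

(** The exact rate is [- |grad g| (z + cos theta)]. *)
Lemma constraint_rate_gt0 z p : grad f p != 0 -> grad g p != 0 ->
  (0 < dot (grad g p) (sfield f g z p)) = (cos (theta f g p) < - z).
Proof.
move=> f0 g0; have [ef eg] := (enorm_gt0 _ f0, enorm_gt0 _ g0).
rewrite /theta cos_angle_lt // dotDr !dotNr [dot _ (z *: _)]dotZr dot_normalize //.
rewrite dotZr dotC.
rewrite -[LHS](pmulr_rgt0 _ ef).
rewrite [X in 0 < X](_ : _ =
  - z * (enorm (grad f p) * enorm (grad g p)) - dot (grad f p) (grad g p)).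
  by rewrite subr_gt0.
by field; rewrite gt_eqF.
Qed.

(** The condition [cos theta <= - z] cleared of denominators: this form is
    continuous on the whole space, including the critical points of [f] and
    [g], where [theta] is meaningless. *)
Definition obtuse z : set 'rV[R]_n :=
  [set p | dot (grad f p) (grad g p)
           + z * (enorm (grad f p) * enorm (grad g p)) <= 0].

Lemma closed_obtuse z : continuous (grad f) -> continuous (grad g) ->
  closed (obtuse z).
Proof.
by move=> cf cg; apply: closed_sublevel; exact: obtuse_continuous.
Qed.

Lemma obtuseE z p : grad f p != 0 -> grad g p != 0 ->
  obtuse z p <-> cos (theta f g p) <= - z.
Proof.
move=> f0 g0; rewrite /theta cos_angle_le // mulNr /obtuse /=.
by rewrite -lerBrDr sub0r.
Qed.

Lemma closure_Theta z p :
  (forall p, feasible g p -> grad f p != 0) ->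
  (forall p, feasible g p -> grad g p != 0) ->
  continuous g -> continuous (grad f) -> continuous (grad g) ->
  closure (Theta f g z) p -> cos (theta f g p) <= - z.
Proof.
move=> rf rg cg cdf cdg clp.
have cl : closed (feasible g `&` obtuse z).
  by apply: closedI; [exact: closed_sublevel|exact: closed_obtuse].
have [fp] : (feasible g `&` obtuse z) p.
  rewrite (proj1 (closure_id _) cl).
  apply: closure_subset clp => q [fq /ltW cosq]; split; first exact: fq.
  by apply/obtuseE; [exact: rf|exact: rg|exact: cosq].
by move/(obtuseE _ _ (rf _ fp) (rg _ fp)).
Qed.
End Field.

(** * Trajectories up to the first arrival at the boundary *)

Lemma C2_continuous {R : realType} {n : nat} (h : 'rV[R]_n -> R) :
  C2 h -> continuous h /\ continuous (grad h).
Proof. by case=> dh dgh _; split=> p; apply: differentiable_continuous. Qed.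

Section Trajectory.
Context {R : realType} {n : nat}.
Variables (f g : 'rV[R]_n -> R) (z : R) (x0 : 'rV[R]_n) (x : R -> 'rV[R]_n).
Hypothesis tr : trajectory f g z x0 x.
Hypothesis hx0 : feasible g x0.
Implicit Types (h : 'rV[R]_n -> R) (a b t T : R).

Lemma trajectory_continuous t : 0 < t -> {for t, continuous x}.
Proof.
move=> t0; have [_ cx _] := tr.
apply: (@within_continuous_continuous _ _ _ 0 (t + 1)).
- by rewrite (lt_trans t0) // ltrDl.
- by apply: continuous_subspaceW cx => s /=; rewrite !in_itv /= => /andP[->].
- by rewrite in_itv /= t0 ltrDl ltr01.
Qed.

(** The differential equation holds at [t] once the curve is feasible on
    [[0, t]], and the mean value theorem differentiates only inside the
    interval: feasibility before [b] suffices, and [b] may be an arrival time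
    at the boundary. *)
Lemma trajectory_MVT h a b : (forall p, differentiable h p) ->
  0 <= a < b -> (forall s, 0 < s < b -> feasible g (x s)) ->
  exists2 c, a < c < b &
    h (x b) - h (x a) = dot (grad h (x c)) (sfield f g z (x c)) * (b - a).
Proof.
move=> dh /andP[a0 ab] feas; have [x00 cx dx] := tr.
have [||c cab ->] := @MVT R (h \o x)
  (fun t => dot (grad h (x t)) (sfield f g z (x t))) a b ab.
- move=> t; rewrite in_itv /= => /andP[at_ tb]; apply: is_derive_comp_grad => //.
  apply: dx => [|s /andP[]]; first exact: le_lt_trans at_.
  rewrite le_eqVlt => /predU1P[<- _|s0 st]; first by rewrite x00.
  by apply: feas; rewrite s0 (le_lt_trans st).
- move=> t; apply: (@continuous_comp (subspace `[a, b]) _ _ x h).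
    apply: continuous_subspaceW cx t => s /=.
    by rewrite !in_itv /= andbT => /andP[/(le_trans a0)].
  exact: differentiable_continuous.
- by exists c; rewrite // -in_itv.
Qed.

Hypothesis df : forall p, differentiable f p.
Hypothesis reg : forall p, feasible g p -> grad f p != 0 /\ grad g p != 0.
Hypothesis z01 : 0 <= z < 1.

Lemma objective_decrease T : 0 < T ->
  (forall s, 0 < s < T -> feasible g (x s)) ->
  exists2 c, 0 < c < T &
    f (x T) <= f x0 - (1 - z) * enorm (grad f (x c)) * T.
Proof.
move=> T0 feas; have [x00 _ _] := tr; have /andP[z0 z1] := z01.
have [|c cT] := trajectory_MVT f 0 T df _ feas; first by rewrite lexx.
rewrite x00 subr0 => fT; exists c => //.
have [f0 g0] := reg _ (feas c cT).
have := objective_rate f g z _ z0 f0 g0.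
by rewrite -(ler_pM2r T0) -fT mulNr; lra.
Qed.

Lemma objective_nonincreasing T : 0 < T ->
  (forall s, 0 < s < T -> feasible g (x s)) -> f (x T) <= f x0.
Proof.
move=> T0 feas; have [c _ fT] := objective_decrease T T0 feas.
have /andP[_ z1] := z01.
apply: (le_trans fT); rewrite gerBl mulr_ge0 ?(ltW T0) //.
by rewrite mulr_ge0 ?sqrtr_ge0 // subr_ge0 ltW.
Qed.

(** A curve that remained feasible would stay in a compact sublevel set of [f],
    on which [|grad f|] is bounded away from [0], so that [f] would tend to
    minus infinity along it. *)
Lemma trajectory_leaves : coercive f -> continuous g -> continuous (grad f) ->
  exists2 t, 0 < t & ~ feasible g (x t).
Proof.
move=> cof cg cdf; apply: contrapT => stay.
have feas t : 0 < t -> feasible g (x t).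
  by move=> t0; apply: contrapT => nf; apply: stay; exists t.
have cf : continuous f by move=> p; exact: differentiable_continuous.
pose K := [set p | f p <= f x0 /\ g p <= 0].
have K0 : K !=set0 by exists x0; split.
have cK : compact K by exact: compact_sublevel.
have inK t : 0 < t -> x t \in K.
  move=> t0; rewrite inE; split; last exact: feas.
  by apply: objective_nonincreasing => // s /andP[s0 _]; exact: feas.
have [q qK qmin] := EVT_min_rV K0 cK
  (continuous_subspaceT (enorm_continuous _ cdf)).
have [r rK rmin] := EVT_min_rV K0 cK (continuous_subspaceT cf).
have m0 : 0 < enorm (grad f q).
  by move: qK; rewrite inE => -[_ /reg[/enorm_gt0]].
have /andP[_ z1] := z01.
have rate0 : 0 < (1 - z) * enorm (grad f q) by rewrite mulr_gt0 // subr_gt0.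
have fr : f r <= f x0 by move: rK; rewrite inE => -[].
(* A time at which a decrease at the minimal rate would take f to f r - 1,
   below its minimum f r on K. *)
pose T := (f x0 - f r + 1) / ((1 - z) * enorm (grad f q)).
have T0 : 0 < T by rewrite divr_gt0 // ltr_wpDl // subr_ge0.
have [s /andP[s0 _]|c /andP[c0 _] fT] := objective_decrease T T0.
  exact: feas.
have : (1 - z) * enorm (grad f q) * T <= (1 - z) * enorm (grad f (x c)) * T.
  rewrite (ler_pM2r T0) ler_pM2l ?subr_gt0; last exact: z1.
  exact: qmin (inK c c0).
rewrite [X in X <= _]mulrC divfK ?gt_eqF // => drop.
by have := rmin _ (inK T T0); rewrite leNgt => /negP; apply; lra.
Qed.

Lemma trajectory_left_nbhs T (B : set 'rV[R]_n) : 0 < T -> nbhs (x T) B ->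
  exists2 a, 0 < a < T & forall t, a < t < T -> B (x t).
Proof.
move=> T0 /(trajectory_continuous T T0)/nbhs_ballP[d /= d0 dB].
exists (Num.max (T / 2) (T - d)) => [|t /andP[]].
  by rewrite lt_max gt_max !divr_gt0 // gtrBl d0 gtr_pMr // invf_lt1 // ltr1n.
rewrite gt_max => /andP[_ dt] tT; apply: dB.
by rewrite /ball /= ger0_norm ?subr_ge0 ?(ltW tT) //; lra.
Qed.

(** The first arrival time is the infimum of the times at which the curve is
    not in the interior.  It is positive because the curve enters the interior
    at once, and it belongs to that set of times because the interior is
    open. *)
Lemma first_reach_exists : coercive f -> continuous g -> continuous (grad f) ->
  enters_interior g x -> exists T, first_reaches_boundary g x T.
Proof.
move=> cof cg cdf /nbhs_ballP[e /= e0 ent].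
have [t1 t10 nt1] := trajectory_leaves cof cg cdf.
pose S := [set t | 0 < t /\ ~ (feasible g)° (x t)].
have eS : lbound S e.
  move=> t [t0 nt]; rewrite leNgt; apply/negP => te; apply: nt; apply: ent => //.
  by rewrite /ball /= sub0r normrN gtr0_norm.
have St1 : S t1 by split=> // /interior_subset.
have infS : has_inf S by split; [exists t1|exists e].
have T0 : 0 < inf S by apply: (lt_le_trans e0); apply: lb_le_inf => //; exists t1.
have before t : 0 < t < inf S -> (feasible g)° (x t).
  move=> /andP[t0 tT]; apply: contrapT => nt.
  have : inf S <= t by apply: ge_inf; [exists e|split].
  by rewrite leNgt tT.
exists (inf S); split; [exact: T0|exact: before|split].
  move=> B /(trajectory_left_nbhs _ _ T0)[a /andP[a0 aT] aB].
  have am : a < (a + inf S) / 2 < inf S by rewrite midf_lt // midf_lt.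
  exists (x ((a + inf S) / 2)); split; last exact: aB.
  by apply: interior_subset; apply: before; move: am; lra.
move=> intT.
have /(trajectory_continuous _ T0)/nbhs_ballP[d /= d0 dint] :
    nbhs (x (inf S)) (feasible g)°.
  by apply: open_nbhs_nbhs; split; [exact: open_interior|].
have [s Ss sd] := inf_adherent d0 infS.
have Ts : inf S <= s by apply: ge_inf Ss; exists e.
apply: (proj2 Ss); apply: dint.
by rewrite /ball /= distrC ger0_norm ?subr_ge0 // ltrBlDl.
Qed.

Hypothesis dg : forall p, differentiable g p.

(** Between any earlier positive time and [T], the value of [g] passes from
    negative to [0], so its rate is positive at an intermediate time; such
    times accumulate at [T]. *)
Lemma first_reach_closure T : first_reaches_boundary g x T ->
  g (x T) = 0 /\ closure (Theta f g z) (x T).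
Proof.
move=> [T0 before bT].
have gT : g (x T) = 0.
  by apply/(boundary_feasible g _ dg) => // /reg[].
split=> // B /(trajectory_left_nbhs _ _ T0)[a /andP[a0 aT] aB].
have feas s : 0 < s < T -> feasible g (x s).
  by move=> /before; exact: interior_subset.
have [|c acT gc] := trajectory_MVT g a T dg _ feas; first by rewrite (ltW a0).
exists (x c); split; last exact: aB.
have fc : feasible g (x c).
  by apply: feas; case/andP: acT => ac ->; rewrite (lt_trans a0).
split=> //; have [f0 g0] := reg _ fc.
rewrite -constraint_rate_gt0 //.
have aT0 : 0 < T - a by rewrite subr_gt0.
rewrite -(pmulr_lgt0 _ aT0) -gc gT sub0r oppr_gt0.
have inta : (feasible g)° (x a) by apply: before; rewrite a0.
have [_ ga0] := reg _ (interior_subset inta).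
exact: interior_feasible_lt0.
Qed.
End Trajectory.

(** * Cluster points of the arrival points *)

Section Limit.
Context {R : realType} {n : nat}.

Lemma obtuse_limit (f g : 'rV[R]_n -> R) (p : 'rV[R]_n) :
  (forall z : R, 0 <= z < 1 -> obtuse f g z p) -> obtuse f g 1 p.
Proof.
rewrite /obtuse /=; set d := dot _ _; set e := _ * enorm _ => ob.
rewrite mul1r leNgt; apply/negP => de.
have d0 : d <= 0 by have := ob 0; rewrite mul0r addr0 lexx ltr01; apply.
have e0 : 0 < e by lra.
(* This number is the midpoint between 1 and - d / e; it is below 1 when
   d + e > 0, and substituting it for z gives (d + e) / 2 > 0. *)
have := ob ((e - d) / (2 * e)).
rewrite divr_ge0 ?ltr_pdivrMr; [|lra..].
have -> : (e - d) / (2 * e) * e = (e - d) / 2 by field; rewrite gt_eqF.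
rewrite mul1r; have -> : e - d < 2 * e by lra.
by move=> /(_ isT); lra.
Qed.
End Limit.

Section ClusterPoints.
Context {T : topologicalType}.

Lemma cluster_closed (F : set_system T) (C : set T) (l : T) :
  closed C -> F C -> cluster F l -> C l.
Proof.
move=> clC FC; rewrite clusterE => /(_ C FC).
by rewrite -(proj1 (closure_id _) clC).
Qed.

Lemma cvg_to_cluster (F : set_system T) (l : T) :
  ProperFilter F -> F --> l -> cluster F l.
Proof.
by move=> PF Fl A B FA /Fl FB; apply: (@filter_ex _ F); exact: filterI.
Qed.
End ClusterPoints.

Theorem theorem5 (R : realType) (n : nat) (f g : 'rV[R]_n -> R) (x0 : 'rV[R]_n)
    (A1 : coercive f)
    (A2 : forall p, feasible g p -> grad f p != 0)
    (A3 : forall p, feasible g p -> grad g p != 0)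
    (A4f : C2 f) (A4g : C2 g)
    (hx0 : feasible g x0) :
  (forall (zeta : R) (x : R -> 'rV[R]_n),
     0 <= zeta < 1 -> trajectory f g zeta x0 x ->
     (enters_interior g x -> exists T, first_reaches_boundary g x T) /\
     (forall T, first_reaches_boundary g x T ->
        (g (x T) = 0 /\ cos (theta f g (x T)) <= - zeta) /\
        closure (Theta f g zeta) (x T))) /\
  (forall (x : R -> R -> 'rV[R]_n) (T : R -> R),
     (forall zeta, 0 <= zeta < 1 -> trajectory f g zeta x0 (x zeta)) ->
     (\forall zeta \near (1 : R)^'-,
        first_reaches_boundary g (x zeta) (T zeta)) ->
     let xsharp := fun zeta => x zeta (T zeta) in
     (forall l, xsharp zeta @[zeta --> (1 : R)^'-] --> l ->
        (central_path f g `&` boundary (feasible g)) l) /\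
     cluster (xsharp zeta @[zeta --> (1 : R)^'-]) !=set0 /\
     cluster (xsharp zeta @[zeta --> (1 : R)^'-])
       `<=` central_path f g `&` boundary (feasible g)).
Proof.
have [cf cdf] := C2_continuous f A4f; have [cg cdg] := C2_continuous g A4g.
have [df _ _] := A4f; have [dg _ _] := A4g.
have reg p (fp : feasible g p) := conj (A2 p fp) (A3 p fp).
have reached zeta x T : 0 <= zeta < 1 -> trajectory f g zeta x0 x ->
    first_reaches_boundary g x T ->
    (g (x T) = 0 /\ cos (theta f g (x T)) <= - zeta) /\
    closure (Theta f g zeta) (x T).
  move=> z01 tr /(first_reach_closure f g zeta x0 x tr hx0 reg dg)[gT clT].
  by split=> //; split=> //; apply: closure_Theta clT.
split=> [zeta x z01 tr|x T tr reach xsharp].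
  split=> [|T]; last exact: reached.
  exact: (first_reach_exists f g zeta x0 x tr hx0 df reg z01).
set F := xsharp zeta @[zeta --> (1 : R)^'-].
have near01 (z : R) : z < 1 -> \forall zeta \near (1 : R)^'-, z <= zeta < 1.
  move=> z1; near=> zeta; apply/andP; split; near: zeta.
    exact: nbhs_left_ge.
  exact: nbhs_left_lt.
have reach01 (z : R) : z < 1 -> \forall zeta \near (1 : R)^'-,
    (z <= zeta < 1) /\ first_reaches_boundary g (x zeta) (T zeta).
  by move=> z1; apply: filterI; [exact: near01|exact: reach].
pose D z := [set p | g p = 0] `&` obtuse f g z.
have FD (z : R) : 0 <= z < 1 -> F (D z).
  move=> /andP[z0 z1]; apply: filterS (reach01 z z1) => zeta [/andP[zz zeta1]].
  have zeta01 : 0 <= zeta < 1 by rewrite (le_trans z0).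
  move=> /(reached _ _ _ zeta01 (tr _ zeta01))[[gT cosT] _]; split=> //.
  have fT : feasible g (xsharp zeta) by rewrite /feasible /= gT.
  apply/obtuseE; [exact: A2|exact: A3|].
  by apply: (le_trans cosT); rewrite lerN2.
have FK : F [set p | f p <= f x0 /\ g p <= 0].
  apply: filterS (reach01 0 ltr01) => zeta [zeta01 reachT]; split.
    have [T0 before _] := reachT.
    apply: (objective_nonincreasing f g zeta x0 _ (tr _ zeta01) hx0 df reg) => //.
    by move=> s /before; exact: interior_subset.
  by have [[gT _] _] := reached _ _ _ zeta01 (tr _ zeta01) reachT; rewrite gT.
have clF l : cluster F l -> (central_path f g `&` boundary (feasible g)) l.
  move=> Fl.
  have lD (z : R) : 0 <= z < 1 -> D z l.
    move=> z01; apply: cluster_closed (FD z z01) Fl.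
    by apply: closedI; [exact: closed_level|exact: closed_obtuse].
  have [|gl _] := lD 0; first by rewrite lexx ltr01.
  have fl : feasible g l by rewrite /feasible /= gl.
  have [f0 g0] := reg l fl.
  split; last exact/(boundary_feasible g l dg (A3 l)).
  split=> //; apply: normalize_opposite => //.
  apply/(obtuseE f g) => //; apply: obtuse_limit => z z01.
  by have [] := lD z z01.
split=> [l|]; first by move=> /cvg_to_cluster/clF.
split=> //.
have [l [_ Fl]] := compact_sublevel f g (f x0) A1 cf cg F _ FK.
by exists l.
Unshelve. all: by end_near. Qed.
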